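(* Let $(X,\mu)$ be a finite probability space, $\mathcal{F}\subseteq\mathcal{P}(X)$ a family of subsets, and $\rho_{\mathcal{F}}(n)$ the thicket shatter function of $\mathcal{F}$. Then for any integer $n\ge 1$ and any $\epsilon>0$, $$\mu^{2^n-1}\left(\left\{\bar x\in X^{2^n-1} : \sup_{S\in\mathcal{F}}|\mathrm{test}(\bar x,S)-\mu(S)|>\epsilon\right\}\right)\le 8\,\rho_{\mathcal{F}}(n)\exp\left(-\frac{n\epsilon^2}{32}\right).$$
   Context: $2^i$ denotes the set of binary sequences of length $i$, and $2^{<n}$ the set of binary sequences of length less than $n$ (so $|2^{<n}|=2^n-1$). A test tree is a tuple $\bar x=(x_\sigma)_{\sigma\in 2^{<n}}\in X^{2^n-1}$ of elements of $X$ indexed by $2^{<n}$; $\mu^{2^n-1}$ is the product measure on such tuples. For binary sequences, $\sigma<\tau$ means $\sigma$ is a proper initial segment of $\tau$, and $|\sigma|$ is the length of $\sigma$. For $S\subseteq X$ define $$\mathrm{test}(\bar x,S):=\frac1n\sum_{i=0}^{n-1}\sum_{\tau\in 2^i}\left(1_S(x_\tau)\cdot\prod_{\sigma<\tau}\chi_S^\tau(x_\sigma)\right),$$ where $1_S$ is the indicator function of $S$, and for $\sigma<\tau$, $\chi_S^\tau(x_\sigma)=1$ if ($x_\sigma\in S\leftrightarrow\tau(|\sigma|)=1$), and $\chi_S^\tau(x_\sigma)=0$ otherwise. (Sequences are indexed from $0$.) A binary element tree of height $n$ with labels from $X$ is a function $T:2^{<n}\to X$, $\sigma\mapsto a_\sigma$.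 A leaf is a binary sequence $\tau$ of length $n$; it is properly labeled by a set $A$ if for all $m<n$, $a_{\tau|_{[m]}}\in A$ iff $\tau(m)=1$, where $[m]=\{0,\dots,m-1\}$. The thicket shatter function $\rho_{\mathcal{F}}(n)$ is the maximum, over binary element trees of height $n$ with labels from $X$, of the number of leaves that are properly labeled by some element of $\mathcal{F}$. *)

(* Defs.v *)
From HB Require Import structures.
From mathcomp Require Import all_boot all_order all_algebra.
From mathcomp Require Import classical_sets reals sequences exp.

Set Implicit Arguments.
Unset Strict Implicit.
Unset Printing Implicit Defensive.

Import Order.TTheory GRing.Theory Num.Theory.
Local Open Scope ring_scope.

(* 2^{<n}: binary sequences of length less than n. *)
Record node (n : nat) := Node {
  node_bseq :> {bseq n of bool};
  _ : (size node_bseq < n)%N }.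

HB.instance Definition _ n := [isSub for @node_bseq n].
HB.instance Definition _ n := [Finite of node n by <:].

Definition proper_prefix (s t : seq bool) : bool := prefix s t && (s != t).

(* 2^n-1 points of X indexed by 2^{<n}: both the test trees and the binary
   element trees of height n with labels from X. *)
Notation tree X n := {ffun node n -> X}.

(* The restriction tau|_[m] of a leaf tau, for m < n. *)
Lemma size_leaf_restr n (tau : n.-tuple bool) (m : 'I_n) :
  (size (take_bseq m tau) < n)%N.
Proof. by rewrite /= size_takel ?size_tuple // ltnW. Qed.

Definition leaf_restr n (tau : n.-tuple bool) (m : 'I_n) : node n :=
  Node (size_leaf_restr tau m).

Definition properly_labeled (X : finType) n (T : tree X n) (A : {set X})
    (tau : n.-tuple bool) : bool :=
  [forall m : 'I_n, (T (leaf_restr tau m) \in A) == tnth tau m].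

Definition thicket_shatter (X : finType) (F : {set {set X}}) (n : nat) : nat :=
  \max_(T : tree X n)
    #|[pred tau : n.-tuple bool | [exists A in F, properly_labeled T A tau]]|.

Section FiniteProbability.
Variable R : realType.

(* A probability measure on a finite set (all subsets measurable), given by
   its mass function. *)
Definition is_prob (X : finType) (mu : X -> R) : Prop :=
  (forall x, 0 <= mu x) /\ \sum_(x : X) mu x = 1.

Definition Pr (X : finType) (mu : X -> R) (E : {pred X}) : R :=
  \sum_(x in E) mu x.

(* The mass function of the product measure on X^I. *)
Definition prod_mass (I X : finType) (mu : X -> R) (f : {ffun I -> X}) : R :=
  \prod_(i : I) mu (f i).

Definition chi (X : finType) n (S : {set X}) (x : tree X n)
    (tau sigma : node n) : R :=
  ((x sigma \in S) == nth false tau (size sigma))%:R.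

Definition test (X : finType) n (x : tree X n) (S : {set X}) : R :=
  n%:R^-1 *
  \sum_(i < n) \sum_(tau : node n | size tau == i)
    ((x tau \in S)%:R *
     \prod_(sigma : node n | proper_prefix sigma tau) chi S x tau sigma).

(* The supremum of |test(x,S) - mu(S)| over S in F; the terms are nonnegative
   and [sup] of the empty set is 0. *)
Definition sup_dev (X : finType) (mu : X -> R) (F : {set {set X}}) n
    (x : tree X n) : R :=
  sup [set d | exists2 S, S \in F & d = `|test x S - Pr mu S| ]%classic.

End FiniteProbability.

(* Main.v *)
Require Import Defs.
From mathcomp Require Import all_boot all_order all_algebra.
From mathcomp Require Import classical_sets reals sequences exp.
From mathcomp Require Import ring lra.

(** Descending a test tree from its root, going to the child given by the
    membership of the current label in [S], traces out one leaf, and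
    [test x S] is the proportion of ones in that leaf.  For a fixed [S] this
    is an average of [n] independent indicators of mean [Pr mu S]; the
    difficulty is that different sets follow different paths.

    The paths disappear once the event is replaced by the expected number of
    leaves that are properly labeled by some deviating [S] in [F].  By
    linearity this expectation is a sum over leaves, and each summand involves
    only the labels along one branch, which are [n] independent points of law
    [mu].  Hence it equals the expected number of deviating traces of [F] on
    one i.i.d. sample of length [n] ([Pr_deviation_le_traces]), and the problem
    becomes the uniform law of large numbers of Vapnik and Chervonenkis.

    A second, ghost, sample [a'] replaces the measure of [S] by an empirical
    count ([ghost_sample]).  Exchanging [a i] and [a' i] according to
    independent fair coins preserves the law of the pair and permutes the
    joint traces, so a union bound over joint traces applies conditionally on
    the samples ([symmetrization]).  A joint trace is a pair of traces, and
    each sample has at most [r := thicket_shatter F n] of them, since a sample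
    is a tree that is constant on levels ([card_trace_le_shatter]).

    With [u := expR (- (n eps^2 / 32))] the total is at most
    [2 * r^2 * (2 * u^2) = 4 * (r * u)^2].  The square of [r] is harmless:
    if [8 * r * u >= 1] the bound claimed is trivial, and otherwise
    [4 * (r * u)^2 <= 8 * r * u]. *)

Import Order.TTheory GRing.Theory Num.Theory.
Local Open Scope ring_scope.

Set Implicit Arguments.
Unset Strict Implicit.

(** * Exponential moments on finite product spaces *)

Section Analysis.
Variable R : realType.
Implicit Types x l t : R.

(** Obtained from [1 - x/2 <= expR (- (x/2))] by squaring and inverting: the
    product [(1 - x/2)^2 * (1 + x + x^2)] exceeds [1] by
    [(x/2)^2 * (1 - 3x + x^2)], which is nonnegative in this range. *)
Lemma expR_le_quadratic x : `|x| <= 4^-1 -> expR x <= 1 + x + x ^+ 2.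
Proof.
rewrite ler_norml => /andP[xl xu].
have y_gt0 : 0 < 1 - x / 2 by lra.
have h : 1 - x / 2 <= expR (- (x / 2)) by exact: expR_ge1Dx.
have e_eq : expR x * expR (- (x / 2)) ^+ 2 = 1.
  by rewrite expr2 -!expRD -[RHS]expR0; congr expR; field.
have e0 := expR_gt0 x.
have h2 : expR x * (1 - x / 2) ^+ 2 <= 1.
  rewrite -[leRHS]e_eq ler_wpM2l ?(ltW e0) // lerXn2r // nnegrE ?expR_ge0 //.
  exact: ltW.
have q_gt0 : 0 < (1 - x / 2) ^+ 2 by rewrite exprn_gt0.
rewrite -(ler_pM2r q_gt0); apply: (le_trans h2).
have : 0 <= (x / 2) ^+ 2 * (1 - 3 * x + x ^+ 2).
  by rewrite mulr_ge0 ?sqr_ge0 //; have := sqr_ge0 x; lra.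
nra.
Qed.

End Analysis.

Section FiniteProducts.
Variable R : realType.

Lemma prod_mass_prod (I A : finType) (m : A -> R) (g : I -> A -> R) :
  \sum_(a : {ffun I -> A}) prod_mass m a * \prod_i g i (a i) =
  \prod_i \sum_y m y * g i y.
Proof.
rewrite bigA_distr_bigA; apply: eq_bigr => a _.
by rewrite /prod_mass big_split.
Qed.

Lemma prod_mass_is_prob (I A : finType) (m : A -> R) :
  is_prob m -> is_prob (@prod_mass R I A m).
Proof.
move=> [m0 m1]; split=> [a|]; first by apply: prodr_ge0.
rewrite -(bigA_distr_bigA (fun=> m)) big1 // => i _.
Qed.

Lemma PrE (A : finType) (m : A -> R) (E : {pred A}) :
  Pr m E = \sum_a m a * (a \in E)%:R.
Proof.
rewrite /Pr big_mkcond; apply: eq_bigr => a _.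
by case: (a \in E); rewrite ?mulr1 ?mulr0.
Qed.

Lemma Pr_ge0 (A : finType) (m : A -> R) (E : {pred A}) :
  is_prob m -> 0 <= Pr m E.
Proof. by move=> [m0 _]; apply: sumr_ge0. Qed.

Lemma Pr_predC (A : finType) (m : A -> R) (E : {pred A}) :
  is_prob m -> Pr m E + Pr m [predC E] = 1.
Proof. by move=> [_ <-]; rewrite /Pr [RHS](bigID (mem E)). Qed.

Lemma Pr_le1 (A : finType) (m : A -> R) (E : {pred A}) :
  is_prob m -> Pr m E <= 1.
Proof.
move=> mP; rewrite -(Pr_predC E mP) lerDl; exact: Pr_ge0.
Qed.

(** Markov's inequality applied to [expR (+- l * sum)].  Each factor of the
    exponential moment is at most [1 + l^2 <= expR (l^2)] by
    [expR_le_quadratic], as the linear term has mean zero.  The summands may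
    depend on the index, so that the lemma serves both for a sample of points
    and for random signs with fixed coefficients. *)
Lemma chernoff (I A : finType) (m : A -> R) (f : I -> A -> R) (l t : R) :
  is_prob m -> (forall i y, `|f i y| <= 1) ->
  (forall i, \sum_y m y * f i y = 0) -> 0 <= l <= 4^-1 ->
  Pr (prod_mass m) [pred a : {ffun I -> A} | `|\sum_i f i (a i)| > t]
    <= 2 * expR (#|I|%:R * l ^+ 2 - l * t).
Proof.
move=> mP f1 f0 /andP[l0 l4]; have [m0 m1] := mP.
have half c : `|c| = l ->
    \sum_(a : {ffun I -> A}) prod_mass m a * expR (c * \sum_i f i (a i))
    <= expR (#|I|%:R * l ^+ 2).
  move=> cE.
  have -> : \sum_(a : {ffun I -> A}) prod_mass m a * expR (c * \sum_i f i (a i))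
          = \prod_(i : I) \sum_y m y * expR (c * f i y).
    rewrite -prod_mass_prod; apply: eq_bigr => a _.
    by rewrite mulr_sumr expR_sum.
  have -> : expR (#|I|%:R * l ^+ 2) = \prod_(i : I) expR (l ^+ 2).
    by rewrite prodr_const -expRM_natl mulr_natl.
  apply: ler_prod => i _; apply/andP; split.
    by apply: sumr_ge0 => y _; rewrite mulr_ge0 ?expR_ge0.
  apply: le_trans (expR_ge1Dx _).
  have -> : 1 + l ^+ 2 =
      \sum_y m y * (1 + c * f i y + l ^+ 2).
    rewrite (eq_bigr (fun y => m y + c * (m y * f i y) + m y * l ^+ 2)).
      by rewrite !big_split /= -mulr_sumr -mulr_suml f0 m1 mulr0 addr0 mul1r.
    by move=> y _; ring.
  apply: ler_sum => y _; rewrite ler_wpM2l //.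
  have cf : `|c * f i y| <= l.
    by rewrite normrM cE ler_piMr.
  apply: le_trans (expR_le_quadratic (le_trans cf l4)) _.
  rewrite lerD2l -(ger0_norm (sqr_ge0 (_ * _))) normrX.
  by rewrite lerXn2r // nnegrE.
rewrite PrE expRD.
have := lerD (half l (ger0_norm l0)) (half (- l) (etrans (normrN l) (ger0_norm l0))).
rewrite -big_split /= -mulr2n -[_ *+ 2]mulr_natl => h.
rewrite [leRHS]mulrA; apply: le_trans (ler_wpM2r (expR_ge0 _) h).
rewrite mulr_suml; apply: ler_sum => a _; rewrite -mulrDr -mulrA ler_wpM2l //.
  exact: prodr_ge0.
rewrite inE; case: ltP => //= [lt_t|_]; last first.
  by rewrite mulr_ge0 ?addr_ge0 ?expR_ge0.
rewrite mulrDl -!expRD; set s := \sum_i _ in lt_t *.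
have [s0|s0] := lerP 0 s.
  rewrite ler_wpDr ?expR_ge0 // -[X in X <= _]expR0 ler_expR.
  by rewrite (ger0_norm s0) in lt_t; rewrite -mulrBr mulr_ge0 // subr_ge0 ltW.
rewrite ler_wpDl ?expR_ge0 // -[X in X <= _]expR0 ler_expR.
by rewrite (ltr0_norm s0) in lt_t; rewrite mulNr -mulrN -mulrBr mulr_ge0 // subr_ge0 ltW.
Qed.

(** Coordinates picked along an injection [h] are again i.i.d.: the tuples
    with prescribed values on the range of [h] form a box, whose mass is a
    product, with factor [1] off that range. *)
Lemma prod_mass_marginal (I J X : finType) (m : X -> R) (h : I -> J)
    (G : {ffun I -> X} -> R) :
  is_prob m -> injective h ->
  \sum_(x : {ffun J -> X}) prod_mass m x * G [ffun i => x (h i)] =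
  \sum_(a : {ffun I -> X}) prod_mass m a * G a.
Proof.
move=> [m0 m1] h_inj.
rewrite (partition_big (fun x : {ffun J -> X} => [ffun i => x (h i)]) xpredT) //=.
apply: eq_bigr => a _.
rewrite (eq_bigr (fun x => prod_mass m x * G a)); last by move=> x /eqP ->.
rewrite -mulr_suml; congr (_ * _).
(* The admissible values at [j] of a tuple that restricts to [a]. *)
pose Q j y := [forall i, (h i == j) ==> (y == a i)].
have -> : \sum_(x : {ffun J -> X} | [ffun i => x (h i)] == a) prod_mass m x =
   \prod_j \sum_(y | Q j y) m y.
  rewrite bigA_distr_big_dep; apply: eq_bigl => x.
  apply/eqP/familyP => [xa j|xQ].
    by apply/forallP => i; apply/implyP => /eqP <-; rewrite -xa ffunE.
  apply/ffunP => i; rewrite ffunE.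
  by have /forallP/(_ i) := xQ (h i); rewrite eqxx => /eqP.
rewrite /prod_mass (bigID (mem (h @: [set: I]))) /= [X in _ * X]big1 ?mulr1.
  rewrite big_imset /=; last by move=> ? ? _ _; exact: h_inj.
  apply: eq_big => [i|i _]; first by rewrite inE.
  rewrite (big_pred1 (a i)) // => y; apply/forallP/eqP => [/(_ i)|-> i'].
    by rewrite eqxx => /eqP.
  by apply/implyP => /eqP/h_inj ->.
move=> j jh; rewrite -[RHS]m1; apply: eq_bigl => y.
by apply/forallP => i; apply/implyP => /eqP hij; rewrite -hij imset_f in jh.
Qed.

End FiniteProducts.

(** * Traces of a family on i.i.d. samples *)

Section Traces.
Variables (R : realType) (I X : finType).
Implicit Types (m : X -> R) (F : {set {set X}}) (a : {ffun I -> X}).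

Definition trace F a : {set {set I}} := [set a @^-1: S | S : {set X} in F].

Definition joint_trace F a a' : {set {set I} * {set I}} :=
  [set (a @^-1: S, a' @^-1: S) | S : {set X} in F].

Lemma card_joint_trace F a a' :
  (#|joint_trace F a a'| <= #|trace F a| * #|trace F a'|)%N.
Proof.
rewrite -cardsX subset_leq_card //; apply/fintype.subsetP => P /imsetP[S SF ->].
by rewrite inE; apply/andP; split; apply: (imset_f (fun S : {set X} => _ @^-1: S)).
Qed.

Lemma card_sum_mem (B : {set I}) : #|B|%:R = \sum_i (i \in B)%:R :> R.
Proof. by rewrite -sum1_card natr_sum big_mkcond; apply: eq_bigr => i _; case: ifP. Qed.

(** The third hypothesis makes the two Chernoff tails together at most one
    half. *)
Lemma Pr_count_close m (S : {set X}) l t :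
  is_prob m -> 0 <= l <= 4^-1 -> 4 * expR (#|I|%:R * l ^+ 2 - l * t) <= 1 ->
  1 <= 2 * Pr (prod_mass m)
    [pred a : {ffun I -> X} | `|#|a @^-1: S|%:R - #|I|%:R * Pr m S| <= t].
Proof.
move=> mP l01 small; have [m0 m1] := mP.
set E := [pred a | _].
have p0 : 0 <= Pr m S by exact: Pr_ge0.
have p1 : Pr m S <= 1 by exact: Pr_le1.
have f1 (i : I) y : `|(y \in S)%:R - Pr m S| <= 1.
  by rewrite ler_norml; case: (y \in S) => /=; apply/andP; split; lra.
have f0 (i : I) : \sum_y m y * ((y \in S)%:R - Pr m S) = 0.
  under eq_bigr do rewrite mulrBr.
  by rewrite sumrB -mulr_suml m1 mul1r -PrE subrr.
have := @chernoff R I X m (fun=> fun y => (y \in S)%:R - Pr m S) l t mP f1 f0 l01.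
rewrite (_ : Pr _ _ = Pr (prod_mass m) [predC E]); last first.
  apply: eq_bigl => a; rewrite !inE -ltNge card_sum_mem sumrB sumr_const mulr_natl.
  by under [in RHS]eq_bigr do rewrite inE.
have := Pr_predC E (prod_mass_is_prob I mP).
clear f1 f0; lra.
Qed.

(** A trace [B] of a set [S] whose count on [a] is off by more than [2 * t] is
    completed, with probability at least one half over [a'], to a joint trace
    whose two counts differ by more than [t]: it suffices that [S] has a
    typical count on [a'].  Different [B] give different joint traces, as [B] is the
    first component. *)
Lemma ghost_sample m F a l t :
  is_prob m -> 0 <= l <= 4^-1 -> 4 * expR (#|I|%:R * l ^+ 2 - l * t) <= 1 ->
  #|trace [set S in F | `|#|a @^-1: S|%:R - #|I|%:R * Pr m S| > 2 * t] a|%:R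
  <= 2 * \sum_a' prod_mass m a' *
     #|[set P in joint_trace F a a' | `|#|P.1|%:R - #|P.2|%:R : R| > t]|%:R.
Proof.
move=> mP l01 small; have [pm0 _] := prod_mass_is_prob I mP.
set Fdev := [set S in F | _]; pose far a' := [set P in joint_trace F a a' |
   `|#|P.1|%:R - #|P.2|%:R : R| > t].
have hB B : B \in trace Fdev a ->
    1 <= 2 * \sum_a' prod_mass m a' * (B \in [set P.1 | P in far a'])%:R.
  case/imsetP => S; rewrite inE => /andP[SF dev] BE.
  apply: le_trans (Pr_count_close S mP l01 small) _.
  rewrite PrE ler_pM2l //; apply: ler_sum => a' _; rewrite ler_wpM2l //.
  rewrite inE; case: (boolP (`|_| <= t)) => [close|_]; last exact: ler0n.
  rewrite (_ : B \in _) //; apply/imsetP; exists (B, a' @^-1: S) => //.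
  rewrite inE BE imset_f //=.
  set u := #|_|%:R in dev *; set v := #|_|%:R in close *.
  have := ler_distD v u (#|I|%:R * Pr m S).
  lra.
rewrite -[X in X%:R <= _]sum1_card natr_sum.
apply: le_trans (ler_sum _ hB) _.
rewrite -mulr_sumr ler_pM2l // exchange_big /=; apply: ler_sum => a' _.
rewrite -mulr_sumr ler_wpM2l // -natr_sum ler_nat.
apply: leq_trans (leq_imset_card fst _).
rewrite -sum1_card big_mkcond [leqRHS]big_mkcond /=; apply: leq_sum => B _.
by case: ifP; case: ifP.
Qed.

Definition swap_sample (s : {ffun I -> bool}) (p : {ffun I -> X} * {ffun I -> X}) :=
  ([ffun i => if s i then p.2 i else p.1 i],
   [ffun i => if s i then p.1 i else p.2 i]).

Definition swap_sets (s : {ffun I -> bool}) (P : {set I} * {set I}) :=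
  ([set i | i \in if s i then P.2 else P.1],
   [set i | i \in if s i then P.1 else P.2]).

Lemma swap_sampleK s : involutive (swap_sample s).
Proof.
by case=> a a'; congr pair; apply/ffunP => i; rewrite !ffunE; case: (s i).
Qed.

Lemma swap_setsK s : involutive (swap_sets s).
Proof.
by case=> B B'; congr pair; apply/setP => i; rewrite !inE; case: ifP; rewrite inE => ->.
Qed.

Lemma joint_trace_swap F s p :
  joint_trace F (swap_sample s p).1 (swap_sample s p).2 =
  swap_sets s @: joint_trace F p.1 p.2.
Proof.
rewrite -imset_comp; apply: eq_imset => S /=.
by congr pair; apply/setP => i; rewrite !inE ffunE; case: (s i); rewrite inE.
Qed.

(** Swapping coordinates by [s] multiplies the [i]-th term of the difference
    of counts by [(-1) ^+ s i], so the left-hand side is also an average over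
    fair coin tosses [s].  Given the samples, each joint trace then contributes
    the probability that a sum of independent signed terms exceeds [t]. *)
Lemma symmetrization m F (r : nat) l t :
  is_prob m -> (forall a, #|trace F a| <= r)%N -> 0 <= l <= 4^-1 ->
  \sum_a prod_mass m a * \sum_a' prod_mass m a' *
     #|[set P in joint_trace F a a' | `|#|P.1|%:R - #|P.2|%:R : R| > t]|%:R
  <= r%:R ^+ 2 * (2 * expR (#|I|%:R * l ^+ 2 - l * t)).
Proof.
move=> mP Fr l01; have [pm0 pm1] := prod_mass_is_prob I mP.
pose d (P : {set I} * {set I}) i : R := (i \in P.1)%:R - (i \in P.2)%:R.
pose sgn (P : {set I} * {set I}) i (b : bool) : R := (-1) ^+ b * d P i.
pose w (p : {ffun I -> X} * {ffun I -> X}) := prod_mass m p.1 * prod_mass m p.2.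
pose K s (p : {ffun I -> X} * {ffun I -> X}) :=
  #|[set P in joint_trace F p.1 p.2 | `|\sum_i sgn P i (s i)| > t]|%:R : R.
have w0 p : 0 <= w p by rewrite mulr_ge0.
have w1 : \sum_p w p = 1.
  rewrite -(pair_bigA _ (fun a a' => prod_mass m a * prod_mass m a')) /=.
  by under eq_bigr do rewrite -mulr_sumr pm1 mulr1.
have swap_w s p : w (swap_sample s p) = w p.
  rewrite /w /prod_mass -!big_split; apply: eq_bigr => i _ /=.
  by rewrite !ffunE; case: (s i) => //; rewrite mulrC.
have swap_K s p : K [ffun=> false] (swap_sample s p) = K s p.
  rewrite /K joint_trace_swap; have sw_inj := inv_inj (swap_setsK s).
  rewrite -[RHS](congr1 (fun k => k%:R) (card_imset _ sw_inj)).
  congr (_%:R); apply: eq_card => Q; rewrite -[Q](swap_setsK s).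
  move: (swap_sets s Q) => P; rewrite finset.in_set !(mem_imset _ _ sw_inj) finset.in_set.
  congr andb; congr (t < `|_|); apply: eq_bigr => i _.
  rewrite /sgn /d ffunE !inE; case: (s i); rewrite ?expr0 ?expr1; ring.
pose coin (b : bool) : R := 2^-1.
have coinP : is_prob coin.
  by split=> [b|]; [rewrite invr_ge0 | rewrite big_bool /= /coin; lra].
have [q0 q1] := prod_mass_is_prob I coinP.
have -> : \sum_a prod_mass m a * \sum_a' prod_mass m a' *
     #|[set P in joint_trace F a a' | `|#|P.1|%:R - #|P.2|%:R : R| > t]|%:R
   = \sum_p w p * K [ffun=> false] p.
  under eq_bigr do rewrite mulr_sumr.
  rewrite pair_bigA /=; apply: eq_bigr => p _.
  rewrite mulrA /K; congr (_ * _%:R); apply: eq_card => P; rewrite !inE.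
  congr andb; congr (t < `|_|); rewrite !card_sum_mem -sumrB.
  by apply: eq_bigr => i _; rewrite /sgn ffunE expr0 mul1r.
have -> : \sum_p w p * K [ffun=> false] p =
   \sum_p w p * \sum_s prod_mass coin s * K s p.
  rewrite -[LHS]mul1r -q1 mulr_suml.
  under [RHS]eq_bigr do rewrite mulr_sumr.
  rewrite [RHS]exchange_big /=; apply: eq_bigr => s _.
  rewrite (reindex_inj (inv_inj (swap_sampleK s))) mulr_sumr.
  by apply: eq_bigr => p _; rewrite swap_w swap_K mulrCA.
set bound := 2 * _.
have bound0 : 0 <= bound by rewrite mulr_ge0 ?expR_ge0.
rewrite -[leRHS]mul1r -[X in _ <= X * _]w1 mulr_suml; apply: ler_sum => p _; rewrite ler_wpM2l //.
have -> : \sum_s prod_mass coin s * K s p =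
   \sum_(P in joint_trace F p.1 p.2)
     Pr (prod_mass coin) [pred s : {ffun I -> bool} | `|\sum_i sgn P i (s i)| > t].
  under [RHS]eq_bigr do rewrite PrE.
  rewrite exchange_big /=; apply: eq_bigr => s _.
  rewrite -mulr_sumr /K -sum1_card natr_sum; congr (_ * _).
  rewrite big_mkcond [RHS]big_mkcond; apply: eq_bigr => P _.
  by rewrite !inE; case: (P \in _) => //=; case: (t < _).
apply: (@le_trans _ _ (#|joint_trace F p.1 p.2|%:R * bound)).
  rewrite mulr_natl -sumr_const; apply: ler_sum => P _.
  apply: chernoff => // [i b|i].
    rewrite /sgn normrM normrX normrN1 expr1n mul1r /d.
    by case: (i \in P.1); case: (i \in P.2);
      rewrite ?subrr ?subr0 ?sub0r ?normrN ?normr0 ?normr1.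
  by rewrite big_bool /= /sgn /coin expr0 expr1; ring.
rewrite ler_wpM2r //. rewrite -natrX ler_nat expnS expn1.
by apply: leq_trans (card_joint_trace _ _ _) _; rewrite leq_mul.
Qed.

End Traces.

(** * From test trees to samples *)

Section TestTrees.
Variables (R : realType) (X : finType) (n : nat).
Implicit Types (x : tree X n) (S : {set X}) (B : {set 'I_n}).

Definition leaf_of B : n.-tuple bool := [tuple i \in B | i < n].

Lemma tnth_leaf_of B i : tnth (leaf_of B) i = (i \in B).
Proof. by rewrite tnth_mktuple. Qed.

Lemma size_leaf_node (tau : n.-tuple bool) (i : 'I_n) :
  size (leaf_restr tau i) = i.
Proof. by rewrite /= size_takel // size_tuple ltnW. Qed.

Lemma leaf_restr_inj (tau : n.-tuple bool) : injective (leaf_restr tau).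
Proof.
by move=> i j /(congr1 (fun v : node n => size v)); rewrite !size_leaf_node => /val_inj.
Qed.

(** The first [k] bits of the branch of [x] determined by [S].  The node
    carrying the current sequence is found by a search, which avoids a proof
    of its length in the recursion; the search succeeds while [k < n]. *)
Fixpoint descent x S k : seq bool :=
  if k is k'.+1 then
    let s := descent x S k' in
    rcons s [exists v : node n, (v == s :> seq bool) && (x v \in S)]
  else [::].

Lemma size_descent x S k : size (descent x S k) = k.
Proof. by elim: k => //= k IH; rewrite size_rcons IH. Qed.

Lemma take_descent x S k m : (m <= k)%N -> take m (descent x S k) = descent x S m.
Proof.
elim: k => [|k IH]; first by rewrite leqn0 => /eqP ->.
rewrite leq_eqVlt => /predU1P[->|]; first by rewrite take_oversize // size_descent.
rewrite ltnS => mk /=; rewrite -cats1 takel_cat ?size_descent //; exact: IH.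
Qed.

Lemma exists_proper_labeling x S : exists B, properly_labeled x S (leaf_of B).
Proof.
have sz : size (descent x S n) == n by rewrite size_descent.
pose tau := Tuple sz; exists [set i | tnth tau i].
have -> : leaf_of [set i | tnth tau i] = tau.
  by apply: eq_from_tnth => i; rewrite tnth_leaf_of inE.
apply/forallP => i; rewrite (tnth_nth false) /= -(nth_take false (ltnSn i)).
rewrite take_descent //= nth_rcons size_descent ltnn eqxx.
have vE : leaf_restr tau i = descent x S i :> seq bool.
  by rewrite /= take_descent // ltnW.
apply/eqP; apply/idP/existsP => [xS|[v /andP[/eqP vd xS]]].
  by exists (leaf_restr tau i); rewrite vE eqxx.
by rewrite (_ : leaf_restr tau i = v) //; do 2!apply: val_inj; exact: etrans vE (esym vd).
Qed.

Lemma properly_labeledE x S B :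
  properly_labeled x S (leaf_of B) =
  ([ffun i => x (leaf_restr (leaf_of B) i)] @^-1: S == B).
Proof.
apply/forallP/eqP => [h|/setP BE i]; last first.
  by rewrite tnth_leaf_of -BE inE ffunE.
by apply/setP => i; rewrite !inE ffunE; have := h i; rewrite tnth_leaf_of => /eqP.
Qed.

(** If every ancestor of [v] agreed with [v], then [v] and [tau], both being
    determined bit by bit by the labels above, would coincide up to level
    [k]. *)
Lemma chi_prod_eq0 x S (tau : n.-tuple bool) (v : node n) (k : 'I_n) :
  properly_labeled x S tau -> size v = k -> v != leaf_restr tau k ->
  \prod_(sigma : node n | proper_prefix sigma v) chi R S x v sigma = 0.
Proof.
move=> /forallP lab vk v_neq; apply/eqP/prodf_eq0.
apply/exists_inP; apply: contraNT v_neq => /exists_inPn h.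
suff agree m : (m <= k)%N -> take m v = take m tau.
  apply/eqP; do 2!apply: val_inj; rewrite /= -(agree k) // -vk.
  by rewrite take_size.
elim: m => [|m IH] mk; first by rewrite !take0.
have mn : (m < n)%N by exact: ltn_trans (ltn_ord k).
have tk : take m v = take m tau by apply: IH; exact: ltnW.
rewrite !(take_nth false) ?vk ?size_tuple // tk; congr rcons.
have := h (leaf_restr tau (Ordinal mn)).
have pp : proper_prefix (leaf_restr tau (Ordinal mn)) v.
  rewrite /proper_prefix /= -tk prefix_take /=; apply: contraTneq mk => e.
  by rewrite -leqNgt -vk -e size_take vk; case: ltnP.
move/(_ pp); rewrite /chi size_leaf_node /= pnatr_eq0 eqb0 negbK => /eqP <-.
by rewrite (eqP (lab _)) (tnth_nth false).
Qed.

Lemma chi_prod_eq1 x S (tau : n.-tuple bool) (k : 'I_n) :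
  properly_labeled x S tau ->
  \prod_(sigma : node n | proper_prefix sigma (leaf_restr tau k))
    chi R S x (leaf_restr tau k) sigma = 1.
Proof.
move=> /forallP lab; apply: big1 => sigma /andP[pre neq].
have sk : (size sigma < k)%N.
  rewrite ltn_neqAle -{2}(size_leaf_node tau k) size_prefix // andbT.
  apply: contra neq => /eqP sk; move: pre; rewrite prefixE => /eqP <-.
  by rewrite sk /= take_takel.
have sn := ltn_trans sk (ltn_ord k).
have sE : sigma = leaf_restr tau (Ordinal sn).
  do 2!apply: val_inj; apply/esym/eqP => /=.
  by move: pre; rewrite prefixE /= take_takel // ltnW.
by rewrite /chi {1}sE (eqP (lab _)) (tnth_nth false) /= nth_take // eqxx.
Qed.

(** At level [k] the only node that contributes is the one on the branch of
    the leaf, and it contributes the bit [k] of that leaf. *)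
Lemma test_properly_labeled x S B :
  properly_labeled x S (leaf_of B) -> test R x S = #|B|%:R / n%:R.
Proof.
move=> lab; rewrite /test mulrC card_sum_mem; congr (_ / _).
apply: eq_bigr => k _.
rewrite (bigD1 (leaf_restr (leaf_of B) k)) /=; last by apply/eqP; exact: (size_leaf_node (leaf_of B) k).
rewrite (chi_prod_eq1 _ lab) mulr1 big1 => [|v /andP[/eqP vk v_neq]].
  by rewrite addr0; have /forallP/(_ k)/eqP -> := lab; rewrite tnth_leaf_of.
by rewrite (chi_prod_eq0 lab vk v_neq) mulr0.
Qed.

(** A sample is read as the tree whose label depends on the level only;
    distinct traces then properly label distinct leaves. *)
Lemma card_trace_le_shatter (F : {set {set X}}) (a : {ffun 'I_n -> X}) :
  (#|trace F a| <= thicket_shatter F n)%N.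
Proof.
pose T : tree X n := [ffun v : node n => a (Ordinal (valP v))].
apply: leq_trans (leq_bigmax T).
have leaf_inj : injective leaf_of.
  by move=> B B' e; apply/setP => i; rewrite -!tnth_leaf_of e.
rewrite -(card_imset _ leaf_inj); apply: subset_leq_card.
apply/fintype.subsetP => _ /imsetP[_ /imsetP[S SF ->] ->].
apply/exists_inP; exists S => //; rewrite properly_labeledE; apply/eqP; apply/setP => i.
rewrite !inE !ffunE; congr (a _ \in S); apply: val_inj; exact: size_leaf_node.
Qed.

Lemma shatter_gt0 (F : {set {set X}}) x S :
  S \in F -> (0 < thicket_shatter F n)%N.
Proof.
move=> SF; have [B lab] := exists_proper_labeling x S.
apply: leq_trans (leq_bigmax x); apply/card_gt0P; exists (leaf_of B).
by apply/exists_inP; exists S.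
Qed.

Lemma sup_dev_gtP (mu : X -> R) (F : {set {set X}}) x (eps : R) :
  0 <= eps -> sup_dev mu F x > eps ->
  exists2 S, S \in F & `|test R x S - Pr mu S| > eps.
Proof.
move=> eps0 dev.
case: (pickP [pred S in F | `|test R x S - Pr mu S| > eps]) => [S /andP[]|noS].
  by exists S.
move: dev; rewrite ltNge => /negP[]; rewrite /sup_dev; set D := [set d | _]%classic.
have ubD : ubound D eps.
  move=> _ [S SF ->]; by have := noS S; rewrite /= SF /= leNgt => ->.
have [->|/set0P D0] := eqVneq D set0; first by rewrite sup0.
exact: ge_sup.
Qed.

(** The probability of a deviation is at most the expected number of leaves
    with a deviating set.  The branch leading to a fixed leaf is an i.i.d.
    sample, so the sum over leaves may be taken on a single sample instead. *)
Lemma Pr_deviation_le_traces (mu : X -> R) (F : {set {set X}}) (eps : R) :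
  is_prob mu -> (0 < n)%N -> 0 <= eps ->
  Pr (prod_mass mu) [pred x : tree X n | sup_dev mu F x > eps] <=
  \sum_(a : {ffun 'I_n -> X}) prod_mass mu a *
    #|trace [set S in F | `|#|a @^-1: S|%:R - n%:R * Pr mu S| > n%:R * eps] a|%:R.
Proof.
move=> muP n0 eps0; have [pm0 _] := prod_mass_is_prob (node n) muP.
pose Fdev (a : {ffun 'I_n -> X}) := [set S in F | `|#|a @^-1: S|%:R - n%:R * Pr mu S| > n%:R * eps].
have nR : 0 < n%:R :> R by rewrite ltr0n.
have -> : \sum_(a : {ffun 'I_n -> X}) prod_mass mu a * #|trace (Fdev a) a|%:R =
  \sum_(x : tree X n) prod_mass mu x * \sum_(B : {set 'I_n})
     (B \in trace (Fdev [ffun i => x (leaf_restr (leaf_of B) i)])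
                  [ffun i => x (leaf_restr (leaf_of B) i)])%:R.
  under [RHS]eq_bigr do rewrite mulr_sumr.
  rewrite [RHS]exchange_big /=.
  under [RHS]eq_bigr => B _ do rewrite (prod_mass_marginal
    (fun a => (B \in trace (Fdev a) a)%:R) muP (@leaf_restr_inj (leaf_of B))).
  rewrite exchange_big /=; apply: eq_bigr => a _.
  by rewrite -mulr_sumr card_sum_mem.
rewrite PrE; apply: ler_sum => x _; rewrite ler_wpM2l // inE.
case: ltP => [dev|_]; last by apply: sumr_ge0 => B _; exact: ler0n.
have [S SF far] := sup_dev_gtP eps0 dev.
have [B lab] := exists_proper_labeling x S.
rewrite (bigD1 B) //= (_ : B \in _); first by rewrite lerDl sumr_ge0.
have BE := lab; rewrite properly_labeledE in BE.
apply/imsetP; exists S; last by rewrite (eqP BE).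
rewrite inE SF (eqP BE) /=; move: far; rewrite (test_properly_labeled lab).
rewrite -(ltr_pM2l nR); congr (_ < _).
by rewrite -{1}(gtr0_norm nR) -normrM mulrBr mulrCA divff ?mulr1 // lt0r_neq0.
Qed.

End TestTrees.

Unset Implicit Arguments.
Set Strict Implicit.

Theorem theorem4p3 (R : realType) (X : finType) (mu : X -> R)
    (mu_prob : is_prob mu) (F : {set {set X}})
    (n : nat) (n_ge1 : (1 <= n)%N) (eps : R) (eps_gt0 : 0 < eps) :
  Pr (@prod_mass R (node n) X mu)
     [pred x : tree X n | sup_dev mu F x > eps]
    <= 8 * (thicket_shatter F n)%:R * expR (- (n%:R * eps ^+ 2 / 32)).
Proof.
have nR : 0 < n%:R :> R by rewrite ltr0n.
set r := thicket_shatter F n; set u := expR _.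
have u_ge0 : 0 <= u by exact: expR_ge0.
have rhs_ge0 : 0 <= 8 * r%:R * u by rewrite !mulr_ge0.
case: (pickP [pred x : tree X n | sup_dev mu F x > eps]) => [x|none]; last first.
  by rewrite /Pr big_pred0.
rewrite inE => /(sup_dev_gtP (ltW eps_gt0))[S SF far].
have r_ge1 : 1 <= r%:R :> R by rewrite ler1n; exact: shatter_gt0 x _ SF.
have eps_le1 : eps <= 1.
  have [B lab] := exists_proper_labeling x S.
  rewrite (test_properly_labeled _ lab) in far; apply: le_trans (ltW far) _.
  have p0 := Pr_ge0 S mu_prob; have p1 := Pr_le1 S mu_prob.
  have q0 : 0 <= #|B|%:R / n%:R :> R by rewrite divr_ge0.
  have q1 : #|B|%:R / n%:R <= 1 :> R.
    by rewrite ler_pdivrMr // mul1r ler_nat -[leqRHS](card_ord n) max_card.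
  by rewrite ler_norml; apply/andP; split; lra.
have [big|small] := leP 1 (8 * r%:R * u).
  exact: le_trans (Pr_le1 _ (prod_mass_is_prob _ mu_prob)) big.
(* The value of [l] minimizing [n * l^2 - l * (n * eps / 2)]; the restriction
   on [l] in the Chernoff bound is met because [eps <= 1]. *)
have l01 : 0 <= eps / 4 <= 4^-1 by apply/andP; split; lra.
have exp_u2 : expR (#|'I_n|%:R * (eps / 4) ^+ 2 - eps / 4 * (n%:R * eps / 2)) = u ^+ 2.
  by rewrite /u [RHS]expr2 -expRD card_ord; congr expR; field.
have u8 : 8 * u < 1.
  by apply: le_lt_trans small; rewrite ler_wpM2r // ler_pMr.
have ghost_small : 4 * u ^+ 2 <= 1 by rewrite expr2; nra.
apply: le_trans (Pr_deviation_le_traces F mu_prob n_ge1 (ltW eps_gt0)) _.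
have step (a : {ffun 'I_n -> X}) : #|trace [set S in F | `|#|a @^-1: S|%:R - n%:R * Pr mu S| > n%:R * eps] a|%:R
  <= 2 * \sum_a' prod_mass mu a' *
     #|[set P in joint_trace F a a' | `|#|P.1|%:R - #|P.2|%:R : R| > n%:R * eps / 2]|%:R.
  have := @ghost_sample R 'I_n X mu F a (eps / 4) (n%:R * eps / 2) mu_prob l01.
  rewrite exp_u2 card_ord (_ : 2 * (n%:R * eps / 2) = n%:R * eps); last by field.
  exact.
have [pm0 _] := prod_mass_is_prob 'I_n mu_prob.
apply: le_trans (ler_sum _ (fun a _ => ler_wpM2l (pm0 a) (step a))) _.
under eq_bigr do rewrite mulrCA.
rewrite -mulr_sumr.
have sym := symmetrization (n%:R * eps / 2) mu_prob (@card_trace_le_shatter X n F) l01.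
rewrite exp_u2 -/r in sym.
apply: le_trans (ler_wpM2l _ sym) _ => //.
have ru0 : 0 <= r%:R * u by rewrite mulr_ge0.
have -> : 2 * (r%:R ^+ 2 * (2 * u ^+ 2)) = 4 * (r%:R * u) ^+ 2 by ring.
rewrite -mulrA in small; rewrite -mulrA expr2; nra.
Qed.
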